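(* For $\mu\in\mathcal M(\mathbb R^d)$ and $\alpha\in\mathbb R$, $$U^\circ_\alpha(\mu)=\operatorname{int}(U_\alpha(\mu))\subseteq\operatorname{cl}(U_\alpha(\mu))\subseteq U^{FB}_\alpha(\mu)\subseteq D_\alpha(\mu).$$ Additionally: (i) $U^\circ_\alpha(\mu)=\{x\in\mathbb R^d:D^\circ(x;\mu)>\alpha\}$. (ii) If $\operatorname{int}(U_\alpha(\mu))\ne\emptyset$, then $\operatorname{cl}(U_\alpha(\mu))=U^{FB}_\alpha(\mu)$. (iii) If $\mu$ has contiguous support at $D_\alpha(\mu)$, then $\operatorname{int}(D_\alpha(\mu))=\operatorname{int}(U_\alpha(\mu))$. (iv) If for each $H'\in\mathcal H(D_\alpha(\mu))$ and each $H\in\mathcal H$ the strict inclusion $H'\subsetneq H$ implies $\mu(H')<\mu(H)$, then $U^{FB}_\alpha(\mu)=D_\alpha(\mu)$. (v) If $\operatorname{int}(U_\alpha(\mu))\neq\emptyset$ and $\mu$ has contiguous support at $D_\alpha(\mu)$, then $\operatorname{cl}(U_\alpha(\mu))=D_\alpha(\mu)$.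
   Context: $\mathcal M(\mathbb R^d)$ is the set of finite Borel measures on $\mathbb R^d$. $\mathcal H$ is the set of closed halfspaces $H_{x,u}=\{y\in\mathbb R^d:\langle x,u\rangle\le\langle y,u\rangle\}$, $x\in\mathbb R^d$, $u\in\mathbb S^{d-1}$ (the unit sphere); $\mathcal H(x)=\{H_{x,u}:u\in\mathbb S^{d-1}\}$. $A^{\mathsf c}=\mathbb R^d\setminus A$; $\operatorname{int},\operatorname{cl},\operatorname{bd}$ denote interior, closure, boundary. Halfspace depth: $D(x;\mu)=\inf_{H\in\mathcal H(x)}\mu(H)$. $D_\alpha(\mu)=\{x:D(x;\mu)\ge\alpha\}$, $U_\alpha(\mu)=\{x:D(x;\mu)>\alpha\}$. Floating body: $U^{FB}_\alpha(\mu)=\bigcap\{H\in\mathcal H:\mu(H^{\mathsf c})\le\alpha\}$. Further, $U^\circ_\alpha(\mu)=\bigcap\{\operatorname{int}(H):H\in\mathcal H,\ \mu(H^{\mathsf c})\le\alpha\}$ and $D^\circ(x;\mu)=\inf\{\mu(\operatorname{int}(H)):H\in\mathcal H,\ x\in H\}$. An intersection over an empty family is $\mathbb R^d$. Touching halfspaces: for a non-empty convex set $A$, $\mathcal H(A)=\{H\in\mathcal H:H\cap\operatorname{cl}(A)\neq\emptyset,\ \operatorname{int}(H)\cap A=\emptyset\}$; $\mathcal H(\emptyset)=\mathcal H$. For a convex proper subset $A\subsetneq\mathbb R^d$, $\mu$ has contiguous support at $A$ if for each $H'\in\mathcal H(A)$ and each $H\in\mathcal H$ with $H'\subsetneq H$,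 $\operatorname{bd}(H)\cap\operatorname{int}(A)\ne\emptyset$ implies $\mu(H')<\mu(H)$. (This condition is only defined for proper subsets, so assuming contiguous support at $D_\alpha(\mu)$ includes $D_\alpha(\mu)\neq\mathbb R^d$.)
   Formalization: Part (iv) is stated for α ≠ 0 only: at α = 0 it fails, e.g. for the Dirac mass at 0, where D_0 = R^d, H(D_0) is empty so the hypothesis is vacuous, but the floating body is {0}. *)

(* Defs.v *)
From mathcomp Require Export all_boot all_order all_algebra.
From mathcomp Require Export all_classical all_reals all_analysis.
Export Order.TTheory GRing.Theory Num.Theory.
Export numFieldNormedType.Exports.

Set Implicit Arguments.
Unset Strict Implicit.
Unset Printing Implicit Defensive.

Local Open Scope classical_set_scope.
Local Open Scope ring_scope.

(* R^d with its Borel sigma-algebra. The carrier is convertible to 'rV[R]_d, so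
   a measure on it applies directly to subsets of 'rV[R]_d. *)
Notation borel_rV R d := (g_sigma_algebraType (@open 'rV[R]_d)).

Section HalfspaceDepth.
Variables (R : realType) (d : nat).
Local Notation V := 'rV[R]_d.
Implicit Types (x u : V) (A H : set V) (a : R).

Definition dotp x u : R := \sum_(i < d) x ord0 i * u ord0 i.

(* Euclidean: the norm `|u| of the library on 'rV is the sup norm. *)
Definition unit_sphere : set V := [set u | dotp u u = 1].

Definition halfspace x u : set V := [set y | dotp x u <= dotp y u].

Definition halfspaces : set (set V) :=
  [set H | exists x u, unit_sphere u /\ H = halfspace x u].

Definition halfspaces_at x : set (set V) :=
  [set halfspace x u | u in unit_sphere].

Definition bd A : set V := closure A `\` interior A.

(* For A = set0 this is the whole set of halfspaces. *)
Definition touching A : set (set V) :=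
  [set H | halfspaces H /\
    (A !=set0 -> H `&` closure A !=set0 /\ interior H `&` A = set0)].

Variable mu : {finite_measure set (borel_rV R d) -> \bar R}.

Definition depth x : \bar R := ereal_inf [set mu H | H in halfspaces_at x].

Definition depth_open x : \bar R :=
  ereal_inf [set mu (interior H) | H in [set H | halfspaces H /\ H x]].

Definition Dreg a : set V := [set x | (a%:E <= depth x)%E].

Definition Ureg a : set V := [set x | (a%:E < depth x)%E].

Definition UFB a : set V :=
  \bigcap_(H in [set H | halfspaces H /\ (mu (~` H) <= a%:E)%E]) H.

Definition Ucirc a : set V :=
  \bigcap_(H in [set H | halfspaces H /\ (mu (~` H) <= a%:E)%E]) interior H.

(* The notion is meant for convex A; convexity is not repeated here since it is
   only applied to the depth regions Dreg, which are convex. *)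
Definition contiguous_support A : Prop :=
  A <> setT /\
  forall H' H, touching A H' -> halfspaces H -> H' `<` H ->
    bd H `&` interior A !=set0 -> (mu H' < mu H)%E.

End HalfspaceDepth.

(* Main.v *)
Require Import Defs.
From mathcomp Require Import lra.

(** Everything is expressed through the masses of the closed halfspaces
    [upper v t] = {y : <y,v> >= t} and of the open halfspaces [supper v t] =
    {y : <y,v> > t}, with v a unit vector. The complement of a closed halfspace
    in direction u is an open halfspace in direction -u, and this turns each
    region into a condition on the halfspaces with x on their boundary.

    A point x lies in the depth region D_a iff every [upper v <x,v>] has mass at
    least a ([DregP]), and in U°_a iff every [supper v <x,v>] has mass more than
    a ([UcircP]). Two limit arguments supply the topology.

    - The mass of [upper v t] is left-continuous in t. A closed halfspace of
      mass less than a can therefore be enlarged, which gives the inclusion of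
      the floating body in D_a and the closedness of D_a.
    - The mass of [supper v <x,v>] is lower semicontinuous in (x,v). As the unit
      sphere is compact, a lower bound that is strict in every direction at x is
      uniform in the direction and near x ([mu_supper_uniform]). Hence U°_a is
      open and is the superlevel set of the open depth.

    A point of the interior of U_a may be pushed a little in the direction v
    without leaving U_a, which replaces [supper v <x,v>] by a smaller closed
    halfspace; so int U_a = U°_a. Assertion (ii) follows: the segment from a
    point of the floating body to a point of U°_a runs in U°_a.

    Assertions (iii) and (iv) reduce to the case a > 0, in which a non-empty D_a
    is compact, because halfspaces far out carry little mass. So D_a has a
    supporting halfspace in every direction v; it contains a point of D_a on its
    boundary, hence has mass at least a ([touching_support]). The hypotheses of
    (iii) and (iv) then give mass more than a to suitable larger halfspaces in
    the direction v: in (iii), to those with an interior point of D_a on their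
    boundary. In (iv), if a point of D_a were outside a halfspace H whose
    complement has mass at most a, such a larger halfspace would fit between the
    supporting one and that complement, a contradiction. Assertion (v) combines
    (iii) with the fact that a convex set with interior points lies in the
    closure of its interior. *)

Local Open Scope classical_set_scope.
Local Open Scope ring_scope.

(** * Halfspaces and the Euclidean inner product *)

Section Geometry.
Set Implicit Arguments.
Unset Strict Implicit.
Variables (R : realType) (d : nat).
Local Notation V := 'rV[R]_d.
Implicit Types (x y z u v w : V) (s t e : R).

Definition upper u t : set V := [set y | t <= dotp y u].

Definition supper u t : set V := [set y | t < dotp y u].

Lemma dotpDl x y u : dotp (x + y) u = dotp x u + dotp y u.
Proof.
by rewrite /dotp -big_split /=; apply: eq_bigr => i _; rewrite !mxE mulrDl.
Qed.

Lemma dotpZl t x u : dotp (t *: x) u = t * dotp x u.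
Proof.
by rewrite /dotp mulr_sumr; apply: eq_bigr => i _; rewrite !mxE mulrA.
Qed.

Lemma dotpNr x u : dotp x (- u) = - dotp x u.
Proof.
by rewrite /dotp -sumrN; apply: eq_bigr => i _; rewrite !mxE mulrN.
Qed.

Lemma dotp_translate u t x : unit_sphere u -> dotp (x + t *: u) u = dotp x u + t.
Proof. by move=> u1; rewrite dotpDl dotpZl u1 mulr1. Qed.

Lemma unit_sphereN u : unit_sphere u -> unit_sphere (- u).
Proof.
rewrite /unit_sphere /= => u1; rewrite dotpNr -(scaleN1r u) dotpZl u1.
by rewrite mulr1 opprK.
Qed.

(** Joint continuity in both arguments is what allows a halfspace to vary with
    its boundary point and its normal at the same time. *)
Lemma dotp_continuous2 : continuous (fun p : V * V => dotp p.1 p.2).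
Proof.
have coordc (i : 'I_d) : continuous (fun x : V => x ord0 i).
  exact: coord_continuous.
have c1 i : continuous (fun q : V * V => q.1 ord0 i).
  move=> q; apply: (@cvg_comp _ _ _ fst (fun x : V => x ord0 i) _ (nbhs q.1)).
    exact: cvg_fst.
  exact: coordc.
have c2 i : continuous (fun q : V * V => q.2 ord0 i).
  move=> q; apply: (@cvg_comp _ _ _ snd (fun x : V => x ord0 i) _ (nbhs q.2)).
    exact: cvg_snd.
  exact: coordc.
move=> p; rewrite /continuous_at /dotp /=.
elim: (index_enum _) => [|i r IHr].
  under eq_fun do rewrite big_nil.
  rewrite big_nil; exact: cvg_cst.
under eq_fun do rewrite big_cons.
rewrite big_cons; apply: cvgD => //.
by apply: cvgM; [exact: c1 | exact: c2].
Qed.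

Lemma dotp_continuous u : continuous (fun y : V => dotp y u).
Proof.
move=> x; apply: (@cvg_comp _ _ _ (fun y : V => (y, u))
  (fun p : V * V => dotp p.1 p.2) _ (nbhs (x, u))).
  exact: (@cvg_pair _ _ _ (nbhs x) (nbhs x) (nbhs u) _ _ _ id (cst u)
    cvg_id (cvg_cst _)).
exact: (@dotp_continuous2 (x, u)).
Qed.

Lemma open_supper u t : open (supper u t).
Proof.
by apply: (@open_comp _ _ (fun y : V => dotp y u) [set s | t < s]) => [x _|];
  [exact: dotp_continuous | exact: open_gt].
Qed.

Lemma closed_upper u t : closed (upper u t).
Proof.
by apply: (@closed_comp _ _ (fun y : V => dotp y u) [set s | t <= s]) => [x _|];
  [exact: dotp_continuous | exact: closed_ge].
Qed.

Lemma translate_near (A : set V) x u : nbhs x A ->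
  exists2 e, 0 < e & forall t, `|t| < e -> A (x + t *: u).
Proof.
move=> Ax.
have : (fun t : R => x + t *: u) t @[t --> (0:R)] --> x.
  rewrite -[X in _ --> X]addr0 -(scale0r u).
  exact: (cvgD (cvg_cst x) (cvgZ cvg_id (cvg_cst u))).
move=> /(_ _ Ax) /nbhs_ballP[e /= e0 He]; exists e => // t te.
by apply: (He t); rewrite /ball/= sub0r normrN.
Qed.

(** Moving a boundary point against the unit normal leaves the halfspace at
    once. *)
Lemma interior_upper u t : unit_sphere u -> interior (upper u t) = supper u t.
Proof.
move=> u1; apply/seteqP; split; last first.
  rewrite -open_subsetE; first by move=> y /ltW.
  exact: open_supper.
move=> x /(translate_near u)[e e0 /(_ (- (e / 2)))].
rewrite /upper /supper /= dotp_translate// normrN gtr0_norm ?divr_gt0//.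
by move=> /(_ ltac:(lra)); lra.
Qed.

Lemma bd_upper u t : unit_sphere u -> bd (upper u t) = [set y | dotp y u = t].
Proof.
move=> u1; rewrite /bd interior_upper//.
rewrite -(closure_id _).1; last exact: closed_upper.
apply/seteqP; split => [y [/= ty /negP]|y /= <-].
  by rewrite -leNgt => yt; apply/eqP; rewrite eq_le yt ty.
by split; rewrite /upper /supper/= ?lexx// ltxx.
Qed.

Lemma upperC u t : ~` upper u t = supper (- u) (- t).
Proof.
apply/seteqP; split => y; rewrite /upper /supper /= dotpNr ltrN2.
  by move/negP; rewrite -ltNge.
by move=> h; apply/negP; rewrite -ltNge.
Qed.

Lemma halfspacesP (H : set V) :
  halfspaces H <-> exists u t, unit_sphere u /\ H = upper u t.
Proof.
split => [[x [u [u1 ->]]]|[u [t [u1 ->]]]]; first by exists u, (dotp x u).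
by exists (t *: u), u; split => //; rewrite /halfspace dotpZl u1 mulr1.
Qed.

(** The boundary point s u of the larger halfspace is not in the smaller one. *)
Lemma upper_proper u s t : unit_sphere u -> s < t -> upper u t `<` upper u s.
Proof.
move=> u1 st; split=> [y|/(_ (s *: u))]; rewrite /upper /=.
  exact/le_trans/ltW.
by rewrite dotpZl u1 mulr1 lexx leNgt st => /(_ isT).
Qed.

(** The library norm of a row vector is the sup norm, so bounds are checked one
    coordinate at a time. *)
Lemma norm_rV_le x M : 0 <= M -> (forall i, `|x ord0 i| <= M) -> `|x| <= M.
Proof.
move=> M0 xM; rewrite -[`|x|]/(mx_norm x) mx_normrE.
by apply: bigmax_le => // -[i j] _ /=; rewrite ord1.
Qed.

Lemma compact_unit_sphere : compact (@unit_sphere R d).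
Proof.
apply: bounded_closed_compact.
  exists 1; split => // M M1 u u1 /=; rewrite (le_trans _ (ltW M1))//.
  apply: norm_rV_le => // j.
  rewrite -(@ler_pXn2r _ 2) ?nnegrE// expr1n real_normK ?num_real//.
  rewrite -u1 /dotp (bigD1 j)//= -expr2 lerDl sumr_ge0// => k _.
  by rewrite -expr2 sqr_ge0.
apply: (@closed_comp _ _ (fun u => dotp u u) [set s | s = 1]) => [u _|].
  apply: (@cvg_comp _ _ _ (fun y : V => (y, y))
    (fun p : V * V => dotp p.1 p.2) _ (nbhs (u, u))).
    exact: (@cvg_pair _ _ _ (nbhs u) (nbhs u) (nbhs u) _ _ _ id id
      cvg_id cvg_id).
  exact: (@dotp_continuous2 (u, u)).
exact: closed_eq.
Qed.

(** The points other than x of the segment from a point x of A to an interior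
    point p of A are interior to A, and they accumulate at x. *)
Lemma convex_sub_closure_interior (A : set V) p :
  (forall x y t, A x -> A y -> 0 < t -> t < 1 -> A (x + t *: (y - x))) ->
  interior A p -> A `<=` closure (interior A).
Proof.
move=> cA Ap x Ax B Bx.
have [e e0 Be] := translate_near (p - x) Bx.
pose t := Num.min (e / 2) (1 / 2).
have t0 : 0 < t by rewrite lt_min !divr_gt0.
have t1 : t < 1 by rewrite /t gt_min; apply/orP; right; lra.
have te : t < e by rewrite /t gt_min; apply/orP; left; lra.
exists (x + t *: (p - x)); split; last by apply: Be; rewrite gtr0_norm.
(* The homothety of ratio t centred at x carries a neighbourhood of p inside A
   to a neighbourhood of this point inside A. *)
pose h y := x + t^-1 *: (y - x).
have hp : h (x + t *: (p - x)) = p.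
  by rewrite /h addrAC subrr add0r scalerA mulVf ?gt_eqF// scale1r subrKC.
have hc : h y @[y --> x + t *: (p - x)] --> p.
  rewrite -[X in _ --> X]hp.
  exact: (cvgD (cvg_cst x) (cvgZ (cvg_cst t^-1) (cvgB cvg_id (cvg_cst x)))).
have hA : nbhs (x + t *: (p - x)) (h @^-1` A) := hc _ Ap.
rewrite /interior /=; apply: filterS hA => y /= Ahy.
have -> : y = x + t *: (h y - x).
  by rewrite /h addrAC subrr add0r scalerA mulfV ?gt_eqF// scale1r subrKC.
exact: cA.
Qed.

End Geometry.

(** * Continuity of the mass of a halfspace *)

Section Measure.
Set Implicit Arguments.
Unset Strict Implicit.
Variables (R : realType) (d : nat).
Local Notation V := 'rV[R]_d.
Variable mu : {finite_measure set (borel_rV R d) -> \bar R}.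
Implicit Types (x y u v : V) (a b s t : R).

Lemma measurable_open_rV (A : set V) :
  open A -> measurable (A : set (borel_rV R d)).
Proof. exact: sub_sigma_algebra. Qed.

Lemma measurable_supper u t : measurable (supper u t : set (borel_rV R d)).
Proof. by apply: measurable_open_rV; exact: open_supper. Qed.

Lemma measurable_upper u t : measurable (upper u t : set (borel_rV R d)).
Proof.
rewrite -[upper u t]setCK upperC.
by apply: measurableC; exact: measurable_supper.
Qed.

Hint Resolve measurable_supper measurable_upper : core.

Lemma le_mu (A B : set (borel_rV R d)) : measurable A -> measurable B ->
  A `<=` B -> (mu A <= mu B)%E.
Proof. by move=> mA mB AB; apply: le_measure; rewrite ?inE. Qed.

Lemma mu_bigcup_gt (F : (set (borel_rV R d))^nat) (b : \bar R) :
  (forall n, measurable (F n)) -> {homo F : n m / (n <= m)%N >-> n `<=` m} ->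
  (b < mu (\bigcup_n F n))%E -> exists n, (b < mu (F n))%E.
Proof.
move=> mF ndF bF.
have muF : mu (F n) @[n --> \oo] --> mu (\bigcup_n F n).
  apply: nondecreasing_cvg_mu => //; first exact: bigcup_measurable.
  by move=> n m nm; apply/subsetPset; exact: ndF.
have [n _ Fn] := muF _ (open_nbhs_nbhs (conj (@open_ereal_gt_ereal _ b) bF)).
by exists n; apply: Fn => /=.
Qed.

Lemma mu_bigcap_lt (F : (set (borel_rV R d))^nat) (b : \bar R) :
  (forall n, measurable (F n)) -> {homo F : n m / (n <= m)%N >-> m `<=` n} ->
  (mu (\bigcap_n F n) < b)%E -> exists n, (mu (F n) < b)%E.
Proof.
move=> mF niF bF.
have muF : mu (F n) @[n --> \oo] --> mu (\bigcap_n F n).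
  apply: nonincreasing_cvg_mu => //.
  - by rewrite ltey_eq fin_num_measure.
  - exact: bigcap_measurable.
  - by move=> n m nm; apply/subsetPset; exact: niF.
have [n _ Fn] := muF _ (open_nbhs_nbhs (conj (@open_ereal_lt_ereal _ b) bF)).
by exists n; apply: Fn => /=.
Qed.

(** A closed halfspace is the intersection of the slightly larger ones in the
    same direction, and a finite measure is continuous along it. *)
Lemma mu_upper_lt u t a : (mu (upper u t) < a%:E)%E ->
  exists2 s, s < t & (mu (upper u s) < a%:E)%E.
Proof.
pose F n : set V := upper u (t - n.+1%:R^-1).
have niF : {homo F : n m / (n <= m)%N >-> m `<=` n}.
  move=> n m nm y; rewrite /F /upper /=; apply: le_trans.
  by rewrite lerB// lef_pV2 ?posrE// ler_nat.
have -> : upper u t = \bigcap_n F n.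
  apply/seteqP; split => [y + n _ | y Fy]; rewrite /F /upper /=.
    by apply: le_trans; rewrite gerBl.
  apply/ler_addgt0Pr => e e0.
  have [n /= ne] : exists n, n.+1%:R^-1 < e.
    by have /filter_ex := near_infty_natSinv_lt (PosNum e0).
  have := Fy n I; rewrite /F /upper /= lerBlDr => /le_trans; apply.
  by rewrite lerD2l ltW.
move=> /(mu_bigcap_lt (fun=> measurable_upper _ _) niF)[n Fn].
by exists (t - n.+1%:R^-1) => //; rewrite gtrBl.
Qed.

(** The halfspaces in a fixed direction decrease to the empty set. *)
Lemma mu_upper_far u a : 0 < a -> exists s, (mu (upper u s) < a%:E)%E.
Proof.
move=> a0; pose F n : set V := upper u n%:R.
have niF : {homo F : n m / (n <= m)%N >-> m `<=` n}.
  by move=> n m nm y; rewrite /F /upper /=; apply: le_trans; rewrite ler_nat.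
have F0 : (mu (\bigcap_n F n) < a%:E)%E.
  suff -> : \bigcap_n F n = set0 by rewrite measure0 lte_fin.
  rewrite -subset0 => y /(_ (Num.truncn (dotp y u)).+1 I).
  by rewrite /F /upper /= leNgt truncnS_gt.
have [n Fn] := mu_bigcap_lt (fun=> measurable_upper _ _) niF F0.
by exists n%:R.
Qed.

(** By continuity from below, mass more than b lies already in an open set W n
    contained in all the halfspaces obtained from perturbations of (x, v) of size
    1/(n+1). *)
Lemma mu_supper_lsc x v (b : \bar R) :
  (b < mu (supper v (dotp x v)))%E ->
  \forall p \near (x, v), (b < mu (supper p.2 (dotp p.1 p.2)))%E.
Proof.
move=> bv.
pose W n : set V := interior [set z |
  forall p : V * V, ball (x, v) n.+1%:R^-1 p -> dotp p.1 p.2 < dotp z p.2].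
have mW n : measurable (W n : set (borel_rV R d)).
  by apply: measurable_open_rV; exact: open_interior.
have ndW : {homo W : n m / (n <= m)%N >-> n `<=` m}.
  move=> n m nm; apply: interiorS => z /= h p pm; apply: h.
  by apply: le_ball pm; rewrite lef_pV2 ?posrE// ler_nat.
have subW : supper v (dotp x v) `<=` \bigcup_n W n.
  move=> z; rewrite /supper /= => zv.
  (* Near (x, v) the threshold is below m, near (z, v) the value is above m. *)
  pose m := (dotp x v + dotp z v) / 2.
  have [xm mz] : dotp x v < m /\ m < dotp z v by rewrite /m; split; lra.
  have /nbhs_ballP[e1 /= e10 h1] : \forall p \near (x, v), dotp p.1 p.2 < m.
    exact: (cvgr_lt _ (@dotp_continuous2 R d (x, v))).
  have /nbhs_ballP[e2 /= e20 h2] : \forall p \near (z, v), m < dotp p.1 p.2.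
    exact: (cvgr_gt _ (@dotp_continuous2 R d (z, v))).
  have e0 : 0 < Num.min e1 e2 by rewrite lt_min e10.
  have [n /=] : exists n, n.+1%:R^-1 < Num.min e1 e2.
    by have /filter_ex := near_infty_natSinv_lt (PosNum e0).
  rewrite lt_min => /andP[ne1 ne2]; exists n => //.
  rewrite /W /interior /=; apply: filterS (nbhsx_ballx z e2 e20).
  move=> y zy p xp.
  apply: (@lt_trans _ _ m); first exact/h1/(le_ball (ltW ne1)).
  apply: (h2 (y, p.2)); split => //=.
  by apply: (le_ball (ltW ne2)); case: xp.
have [n bn] : exists n, (b < mu (W n))%E.
  apply: mu_bigcup_gt => //; apply: (lt_le_trans bv); apply: le_mu => //.
  exact: bigcup_measurable.
apply: filterS (nbhsx_ballx (x, v) n.+1%:R^-1 _) => [p xp|//].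
apply: (lt_le_trans bn); apply: le_mu => // z /interior_subset /=; exact.
Qed.

(** Each direction v has, by lower semicontinuity, a bound b > a that holds for
    all directions near v and all points near x; finitely many of these
    neighbourhoods cover the compact sphere, and the least of their bounds is
    uniform. *)
Lemma mu_supper_uniform x a :
  (forall v, unit_sphere v -> (a%:E < mu (supper v (dotp x v)))%E) ->
  exists2 b, a < b & \forall y \near x, forall v, unit_sphere v ->
    (b%:E <= mu (supper v (dotp y v)))%E.
Proof.
move=> xa.
have /compact_near_coveringP cov := @compact_unit_sphere R d.
(* The bound and the base point are the parameters that compactness makes
   independent of the direction. *)
pose P (i : R * V) v := (i.1%:E <= mu (supper v (dotp i.2 v)))%E.
have : \forall i \near (a^'+, nbhs x), @unit_sphere R d `<=` P i.
  apply: (cov _ (filter_prod a^'+ (nbhs x)) P) => v /xa av.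
  have finv : mu (supper v (dotp x v)) \is a fin_num by exact: fin_num_measure.
  move: av; rewrite -(fineK finv) lte_fin.
  set m := fine _ => am; pose b := (a + m) / 2.
  have [ab bm] : a < b /\ b < m by rewrite /b; split; lra.
  have /mu_supper_lsc [[A B]/= [xA vB] AB] : (b%:E < mu (supper v (dotp x v)))%E.
    by rewrite -(fineK finv) lte_fin.
  exists (B, [set i : R * V | i.1 < b /\ A i.2]) => /=.
    split => //; exists ([set c | c < b], A) => //=; split => //.
    exact: nbhs_right_lt.
  move=> [w [c y]] /= [Bw [cb Ay]]; rewrite /P /=.
  by apply/ltW/lt_trans/(AB (y, w)) => //; rewrite lte_fin.
move=> [[C A]/= [aC xA] CA].
have /filter_ex[b [ab Cb]] : \forall b \near a^'+, a < b /\ C b.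
  by near=> b; split; near: b => //; exact: nbhs_right_gt.
by exists b => //; apply: filterS xA => y Ay v v1; exact: (CA (b, y)).
Unshelve. all: by end_near. Qed.

End Measure.

(** * Depth regions and floating bodies *)

Section Regions.
Set Implicit Arguments.
Unset Strict Implicit.
Variables (R : realType) (d : nat).
Local Notation V := 'rV[R]_d.
Variable mu : {finite_measure set (borel_rV R d) -> \bar R}.
Implicit Types (x y p q u v : V) (a b s t : R).

Lemma le_mu_upper u s t : s <= t -> (mu (upper u t) <= mu (upper u s))%E.
Proof.
move=> st; apply: le_mu; [exact: measurable_upper | exact: measurable_upper |].
by move=> y; exact: le_trans.
Qed.

Lemma le_mu_supper u s t : s <= t -> (mu (supper u t) <= mu (supper u s))%E.
Proof.
move=> st; apply: le_mu; [exact: measurable_supper | exact: measurable_supper |].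
by move=> y; exact: le_lt_trans.
Qed.

Lemma le_mu_upper_supper u s t :
  s < t -> (mu (upper u t) <= mu (supper u s))%E.
Proof.
move=> st; apply: le_mu; [exact: measurable_upper | exact: measurable_supper |].
by move=> y; exact: lt_le_trans.
Qed.

Lemma le_mu_supper_upper u t : (mu (supper u t) <= mu (upper u t))%E.
Proof.
apply: le_mu; [exact: measurable_supper | exact: measurable_upper |].
by move=> y; exact: ltW.
Qed.

Lemma DregP a x : Dreg mu a x <->
  forall v, unit_sphere v -> (a%:E <= mu (upper v (dotp x v)))%E.
Proof.
split=> [/ereal_infP h v v1|h].
  by apply: h; exists (upper v (dotp x v)) => //; exists v.
by apply/ereal_infP => _ [_ [v v1 <-] <-]; exact: h.
Qed.

Lemma Ureg_gt a x v : Ureg mu a x -> unit_sphere v ->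
  (a%:E < mu (upper v (dotp x v)))%E.
Proof.
move=> Ux v1; apply: (lt_le_trans Ux); apply: ereal_inf_lbound.
by exists (upper v (dotp x v)) => //; exists v.
Qed.

(** The complement of H is an open halfspace in the opposite direction. A point
    outside the interior of H lies in the closure of this open halfspace, and
    translating its boundary to the point can only lower its mass. *)
Lemma UcircP a x : Ucirc mu a x <->
  forall v, unit_sphere v -> (a%:E < mu (supper v (dotp x v)))%E.
Proof.
split=> [Ux v v1|h _ [/halfspacesP[u [t [u1 ->]]] aH]].
  rewrite ltNge; apply/negP => av.
  have : interior (upper (- v) (- dotp x v)) x.
    apply: Ux; split; first by apply/halfspacesP; exists (- v), (- dotp x v);
      split => //; exact: unit_sphereN.
    by rewrite upperC !opprK.
  rewrite (interior_upper _ (unit_sphereN v1)) /supper /= dotpNr.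
  by rewrite ltxx.
rewrite interior_upper// /supper /= ltNge; apply/negP => xt.
have := h _ (unit_sphereN u1); apply/negP; rewrite -leNgt.
apply: le_trans aH; rewrite upperC; apply: le_mu_supper.
by rewrite dotpNr lerN2.
Qed.

(** The infimum defining the open depth may exceed a only if it does so with a
    margin, whereas membership in U°_a is a strict inequality for each halfspace
    separately; uniformity over the sphere bridges the two. *)
Lemma Ucirc_depth_open a :
  Ucirc mu a = [set x | (a%:E < depth_open mu x)%E].
Proof.
apply/seteqP; split => x /=.
  move/UcircP/mu_supper_uniform => [b ab /nbhs_singleton xb].
  rewrite (@lt_le_trans _ _ b%:E) ?lte_fin//.
  apply/ereal_infP => _ [_ [/halfspacesP[u [t [u1 ->]]] xt] <-].
  rewrite interior_upper//; apply: (le_trans (xb u u1)).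
  exact: le_mu_supper.
move=> ax; apply/UcircP => v v1; apply: (lt_le_trans ax).
apply: ereal_inf_lbound; exists (upper v (dotp x v)).
  by split; [exists x, v | rewrite /upper /=].
by rewrite interior_upper.
Qed.

Lemma open_Ucirc a : open (Ucirc mu a).
Proof.
rewrite openE => x /UcircP/mu_supper_uniform[b ab].
rewrite /interior /=; apply: filterS => y yb; apply/UcircP => v v1.
by rewrite (@lt_le_trans _ _ b%:E) ?lte_fin// yb.
Qed.

(** A point of int U_a is moved inside U_a by e/2 in the direction v, and the
    closed halfspace through the new point lies in the open one through the old
    point. *)
Lemma Ucirc_interior_Ureg a : Ucirc mu a = interior (Ureg mu a).
Proof.
apply/seteqP; split.
  rewrite -open_subsetE; last exact: open_Ucirc.
  rewrite Ucirc_depth_open => x /= /lt_le_trans; apply.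
  apply/ereal_infP => _ [_ [v v1 <-] <-].
  apply: le_trans (le_mu_supper_upper _ _).
  apply: ereal_inf_lbound; exists (upper v (dotp x v)).
    by split; [exists x, v | rewrite /upper /=].
  by rewrite interior_upper.
move=> x Ux; apply/UcircP => v v1.
have [e e0 /(_ (e / 2))] := translate_near v Ux.
rewrite gtr0_norm ?divr_gt0// => /(_ ltac:(lra)) /Ureg_gt /(_ v1).
move=> /lt_le_trans; apply; apply: le_mu_upper_supper.
by rewrite dotp_translate// ltrDl divr_gt0.
Qed.

(** A point outside a halfspace H lies in the open complement of H together with
    a parallel closed halfspace, so its depth is at most the mass of that
    complement. *)
Lemma closure_Ureg_UFB a : closure (Ureg mu a) `<=` UFB mu a.
Proof.
have cFB : closed (UFB mu a).
  by apply: closed_bigI => _ [/halfspacesP[u [t [u1 ->]]] _]; exact: closed_upper.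
rewrite (closure_id (UFB mu a)).1 //; apply: closureS => x Ux.
move=> _ [/halfspacesP[u [t [u1 ->]]] aH].
rewrite /upper /= leNgt; apply/negP => xt.
have := Ureg_gt Ux (unit_sphereN u1); apply/negP; rewrite -leNgt.
apply: le_trans aH; rewrite upperC; apply: le_mu_upper_supper.
by rewrite dotpNr ltrN2.
Qed.

(** A closed halfspace of mass less than a with x on its boundary can be enlarged
    while its mass stays below a; the closure of the complement of the enlarged
    halfspace is one of the halfspaces that define the floating body, and it does
    not contain x. *)
Lemma UFB_Dreg a : UFB mu a `<=` Dreg mu a.
Proof.
move=> x Fx; apply/DregP => v v1; rewrite leNgt; apply/negP.
move=> /mu_upper_lt[s sx sa].
have : upper (- v) (- s) x.
  apply: Fx; split; first by apply/halfspacesP; exists (- v), (- s);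
    split => //; exact: unit_sphereN.
  rewrite upperC !opprK; apply: le_trans (ltW sa); exact: le_mu_supper_upper.
by rewrite /upper /= dotpNr lerN2 leNgt sx.
Qed.

(** On the segment from a point x of the floating body to a point of U°_a, every
    point other than x is interior to all the halfspaces that define both. *)
Lemma UFB_closure_Ureg a : interior (Ureg mu a) !=set0 ->
  UFB mu a `<=` closure (Ureg mu a).
Proof.
rewrite -Ucirc_interior_Ureg => -[p Up] x Fx B Bx.
have [e e0 Be] := translate_near (p - x) Bx.
pose t := Num.min (e / 2) 1.
have t0 : 0 < t by rewrite lt_min !divr_gt0/=.
have t1 : t <= 1 by rewrite ge_min lexx orbT.
have te : t < e by rewrite /t gt_min; apply/orP; left; lra.
exists (x + t *: (p - x)); split; last by apply: Be; rewrite gtr0_norm.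
apply: interior_subset; rewrite -Ucirc_interior_Ureg => H HH.
have := Up H HH; have := Fx H HH.
case: HH => /halfspacesP[u [s [u1 ->]]] _.
rewrite interior_upper// /upper /supper /= dotpDl dotpZl dotpDl -scaleN1r dotpZl.
move=> sx sp.
have : 0 <= (1 - t) * (dotp x u - s) by rewrite mulr_ge0 ?subr_ge0.
have : 0 < t * (dotp p u - s) by rewrite mulr_gt0 ?subr_gt0.
lra.
Qed.

(** For each direction v, the halfspace through a point of the segment contains
    the one through the end with the larger inner product with v. *)
Lemma convex_Dreg a x y t : Dreg mu a x -> Dreg mu a y -> 0 < t -> t < 1 ->
  Dreg mu a (x + t *: (y - x)).
Proof.
move=> /DregP Dx /DregP Dy t0 t1; apply/DregP => v v1.
rewrite dotpDl dotpZl dotpDl -(scaleN1r x) dotpZl mulN1r.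
have [yx|xy] := leP (dotp y v) (dotp x v).
  apply: le_trans (Dx v v1) (le_mu_upper _ _).
  by rewrite gerDl pmulr_rle0// subr_le0.
apply: le_trans (Dy v v1) (le_mu_upper _ _).
have : 0 < (1 - t) * (dotp y v - dotp x v) by rewrite mulr_gt0 ?subr_gt0.
lra.
Qed.

Lemma Dreg_le0 a : a <= 0 -> Dreg mu a = setT.
Proof.
move=> a0; rewrite -subTset => x _; apply/DregP => v v1.
by apply: (@le_trans _ _ 0%:E); rewrite ?lee_fin.
Qed.

(** If the halfspace in direction v through x has mass less than a, then so does
    a slightly larger one, which contains the halfspaces in direction v through
    all points near x. *)
Lemma closed_Dreg a : closed (Dreg mu a).
Proof.
rewrite -[Dreg mu a]setCK; apply: open_closedC; rewrite openE => x /DregP.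
move=> /existsNP[v /not_implyP[v1 /negP]].
rewrite -ltNge => /mu_upper_lt[s sx sa].
have : nbhs x (supper v s).
  by apply: open_nbhs_nbhs; split => //; exact: open_supper.
rewrite /interior /=; apply: filterS => y.
rewrite /supper /= => sy /DregP/(_ v v1).
apply/negP; rewrite -ltNge; apply: le_lt_trans sa.
exact/le_mu_upper/ltW.
Qed.

Lemma Dreg_bounded_dir a v : 0 < a -> unit_sphere v ->
  exists s, forall x, Dreg mu a x -> dotp x v <= s.
Proof.
move=> a0 v1; have [s sa] := mu_upper_far mu v a0.
exists s => x /DregP/(_ v v1) ax; rewrite leNgt; apply/negP => sx.
have := lt_le_trans sa (le_trans ax (le_mu_upper _ (ltW sx))).
by rewrite ltxx.
Qed.

(** Boundedness is tested on the directions of the coordinate vectors and of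
    their opposites. *)
Lemma compact_Dreg a : 0 < a -> compact (Dreg mu a).
Proof.
move=> a0; apply: bounded_closed_compact; last exact: closed_Dreg.
pose E i : V := delta_mx ord0 i.
have dotE x i : dotp x (E i) = x ord0 i.
  rewrite /dotp (bigD1 i)//= !mxE !eqxx mulr1 big1 ?addr0// => j ji.
  by rewrite !mxE (negbTE ji) andbF mulr0.
have E1 i : unit_sphere (E i) by rewrite /unit_sphere /= dotE mxE !eqxx.
have /choice[f fP] : forall i : 'I_d, exists s, forall x, Dreg mu a x ->
    `|x ord0 i| <= s.
  move=> i; have [s sP] := Dreg_bounded_dir a0 (E1 i).
  have [t tP] := Dreg_bounded_dir a0 (unit_sphereN (E1 i)).
  exists (Num.max s t) => x Dx; have := sP x Dx; have := tP x Dx.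
  rewrite dotpNr dotE ler_norml le_max => xt xs.
  by rewrite xs /= lerNl le_max xt orbT.
exists (\sum_i `|f i|); split; first by rewrite num_real.
move=> M sM x Dx /=; apply: (le_trans _ (ltW sM)).
apply: norm_rV_le => [|i]; first by apply: sumr_ge0.
apply: (le_trans (fP i x Dx)); apply: (le_trans (ler_norm _)).
by rewrite (bigD1 i)//= lerDl sumr_ge0.
Qed.

(** Compactness provides a point y of the region that is extreme in the
    direction v. The supporting halfspace through y has mass at least a because
    y has depth at least a. *)
Lemma touching_support a x v : 0 < a -> Dreg mu a x -> unit_sphere v ->
  exists y, [/\ Dreg mu a y, forall z, Dreg mu a z -> dotp z v <= dotp y v,
    touching (Dreg mu a) (upper v (dotp y v)) &
    (a%:E <= mu (upper v (dotp y v)))%E].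
Proof.
move=> a0 Dx v1.
have [|||y] := @EVT_max_rV R d (fun z => dotp z v) (Dreg mu a).
- by exists x.
- exact: compact_Dreg.
- exact/continuous_subspaceT/dotp_continuous.
rewrite inE => Dy ymax.
have {}ymax z : Dreg mu a z -> dotp z v <= dotp y v.
  by move=> Dz; apply: ymax; rewrite inE.
exists y; split=> //; last exact: (DregP a y).1.
split; first by apply/halfspacesP; exists v, (dotp y v).
move=> _; split.
  by exists y; split; [rewrite /upper /= | exact: subset_closure].
rewrite interior_upper// -subset0 => z [yz /ymax].
by rewrite leNgt; apply/negP; rewrite negbK.
Qed.

(** The halfspace in direction v through an interior point of the region strictly
    contains the supporting one in the same direction, which has mass at least
    a already. *)
Lemma contiguous_gt a q v : contiguous_support mu (Dreg mu a) ->
  interior (Dreg mu a) q -> unit_sphere v ->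
  (a%:E < mu (upper v (dotp q v)))%E.
Proof.
move=> [DT cs] Dq v1.
have a0 : 0 < a by rewrite ltNge; apply/negP => /Dreg_le0.
have [y [Dy ymax ytouch ay]] := touching_support a0 (interior_subset Dq) v1.
apply: (le_lt_trans ay); apply: cs => //.
- by apply/halfspacesP; exists v, (dotp q v).
- apply: upper_proper => //.
  have [e e0 /(_ (e / 2))] := translate_near v Dq.
  rewrite gtr0_norm ?divr_gt0// => /(_ ltac:(lra)) /ymax.
  by rewrite dotp_translate//; apply: lt_le_trans; rewrite ltrDl divr_gt0.
- by exists q; rewrite bd_upper.
Qed.

(** Moving x by e/2 in the direction v inside int D_a reduces the open halfspace
    through x to a closed one through an interior point. *)
Lemma interior_Dreg a : contiguous_support mu (Dreg mu a) ->
  interior (Dreg mu a) = interior (Ureg mu a).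
Proof.
move=> cs; apply/seteqP; split; last by apply: interiorS => x /ltW.
rewrite -Ucirc_interior_Ureg => x Dx; apply/UcircP => v v1.
have : interior (interior (Dreg mu a)) x by exact: nbhs_interior.
move=> /(translate_near v)[e e0 /(_ (e / 2))].
rewrite gtr0_norm ?divr_gt0// => /(_ ltac:(lra)) /contiguous_gt -/(_ _ cs v1).
move=> /lt_le_trans; apply; apply: le_mu_upper_supper.
by rewrite dotp_translate// ltrDl divr_gt0.
Qed.

(** The level 0 is excluded: the region is then the whole space, which no
    halfspace touches, so the hypothesis on masses says nothing, while the
    floating body may be smaller. *)
Lemma Dreg_UFB a : a != 0 ->
  (forall H' H : set V, touching (Dreg mu a) H' -> halfspaces H ->
    H' `<` H -> (mu H' < mu H)%E) ->
  Dreg mu a `<=` UFB mu a.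
Proof.
move=> a_neq0 strict x Dx _ [/halfspacesP[u [t [u1 ->]]] aH].
(* The level bounds the mass of the complement of a halfspace. *)
have a0 : 0 < a.
  rewrite lt_neqAle eq_sym a_neq0 -lee_fin; exact: le_trans aH.
rewrite /upper /= leNgt; apply/negP => xt.
have v1 := unit_sphereN u1; set v := - u in v1.
have [y [Dy ymax ytouch ay]] := touching_support a0 Dx v1.
have ty : - t < dotp y v.
  by apply: (lt_le_trans _ (ymax _ Dx)); rewrite dotpNr ltrN2.
(* A halfspace between the supporting one and the complement of H, which has
   mass at most a. *)
pose s := (- t + dotp y v) / 2.
have [ts sy] : - t < s /\ s < dotp y v by rewrite /s; split; lra.
have : (mu (upper v (dotp y v)) < mu (upper v s))%E.
  apply: strict => //; last exact: upper_proper.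
  by apply/halfspacesP; exists v, s.
move=> /(le_lt_trans ay)/lt_le_trans /(_ (le_mu_upper_supper _ ts)).
by rewrite ltNge -upperC aH.
Qed.

End Regions.

Theorem theorem9 (R : realType) (d : nat) (hd : (0 < d)%N)
  (mu : {finite_measure set (borel_rV R d) -> \bar R}) (a : R) :
  (Ucirc mu a = interior (Ureg mu a)
    /\ interior (Ureg mu a) `<=` closure (Ureg mu a)
    /\ closure (Ureg mu a) `<=` UFB mu a
    /\ UFB mu a `<=` Dreg mu a) /\
  (Ucirc mu a = [set x | (a%:E < depth_open mu x)%E]) /\
  (interior (Ureg mu a) !=set0 -> closure (Ureg mu a) = UFB mu a) /\
  (contiguous_support mu (Dreg mu a) ->
    interior (Dreg mu a) = interior (Ureg mu a)) /\
  (a != 0 ->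
    (forall H' H : set 'rV[R]_d, touching (Dreg mu a) H' -> halfspaces H ->
      H' `<` H -> (mu H' < mu H)%E) ->
    UFB mu a = Dreg mu a) /\
  (interior (Ureg mu a) !=set0 -> contiguous_support mu (Dreg mu a) ->
    closure (Ureg mu a) = Dreg mu a).
Proof.
split; first by split; [exact: Ucirc_interior_Ureg
  | split; [exact: subset_trans (@interior_subset _ _) (@subset_closure _ _)
  | split; [exact: closure_Ureg_UFB | exact: UFB_Dreg]]].
have ii : interior (Ureg mu a) !=set0 -> closure (Ureg mu a) = UFB mu a.
  by move=> U0; apply/seteqP; split;
    [exact: closure_Ureg_UFB | exact: UFB_closure_Ureg].
split; first exact: Ucirc_depth_open.
split=> //; split; first exact: interior_Dreg.
split=> [a0 strict | U0 cs]; apply/seteqP; split.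
- exact: UFB_Dreg.
- exact: Dreg_UFB.
- by rewrite ii//; exact: UFB_Dreg.
- move: (U0) => [p]; rewrite -interior_Dreg// => Dp.
  apply: (subset_trans (convex_sub_closure_interior (@convex_Dreg _ _ _ _) Dp)).
  by rewrite interior_Dreg//; apply: closureS; exact: interior_subset.
Qed.
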